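(* Let $M>0$, $n\ge3$, $\delta\in(0,1)$, let $J_0$ be a fixed $n\times n$ interaction matrix with $\|J_0\|_\infty\le1$, and let $\beta^*$ be an unknown real parameter satisfying $|\beta^*|\le M$. Then there exists an estimator $\hat\beta$ from a single sample $x\sim\Pr_{\beta^*J_0}$ such that with probability at least $1-\delta$, $$|\hat\beta-\beta^*|\le C(M)\,F(\beta^*J_0)^{-1/2}\big(\log\log n+\log(1/\delta)\big),$$ where $C(M)$ depends only on $M$.
   Context: An interaction matrix is a real symmetric $n\times n$ matrix $J$ with zero diagonal. The Ising model is the distribution on $\{\pm1\}^n$ given by $\Pr_J[x]=\exp(x^\top Jx/2-F(J)-n\log2)$, where $F(J)=\log\big(2^{-n}\sum_{x\in\{\pm1\}^n}\exp(x^\top Jx/2)\big)\ge0$ is the log-partition function. $\|J\|_\infty=\max_i\sum_j|J_{ij}|$. If $F(\beta^*J_0)=0$, the right-hand side is read as $+\infty$. *)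

(* Defs.v *)
From HB Require Import structures.
From mathcomp Require Import all_boot all_order all_algebra.
From mathcomp Require Import all_classical all_reals all_analysis.
Set Implicit Arguments.
Unset Strict Implicit.
Unset Printing Implicit Defensive.
Import Order.TTheory GRing.Theory Num.Theory.
Local Open Scope ring_scope.

Definition interaction_matrix (R : realType) (n : nat) (J : 'M[R]_n) : Prop :=
  J^T = J /\ forall i, J i i = 0.

(* The maximum is over nonnegative numbers, so seeding it with 0 changes
   nothing for n > 0. *)
Definition infnorm (R : realType) (n : nat) (J : 'M[R]_n) : R :=
  \big[Num.max/0]_(i < n) \sum_(j < n) `|J i j|.

(* {-1,1}^n, as a finite type: true encodes +1 and false encodes -1. *)
Definition config (n : nat) := {ffun 'I_n -> bool}.

Definition spin (R : realType) (n : nat) (x : config n) : 'cV[R]_n :=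
  \col_i (if x i then 1 else -1).

Definition quad (R : realType) (n : nat) (J : 'M[R]_n) (x : config n) : R :=
  ((spin R x)^T *m J *m spin R x) 0 0.

Definition log_partition (R : realType) (n : nat) (J : 'M[R]_n) : R :=
  ln (2 ^- n * \sum_(x : config n) expR (quad J x / 2)).

Definition ising_pmf (R : realType) (n : nat) (J : 'M[R]_n) (x : config n) : R :=
  expR (quad J x / 2 - log_partition J - n%:R * ln 2).

Definition ising_pr (R : realType) (n : nat) (J : 'M[R]_n)
    (E : {set config n}) : R :=
  \sum_(x in E) ising_pmf J x.

Lemma ising_pr_setT (R : realType) (n : nat) (J : 'M[R]_n) :
  ising_pr J [set: config n] = 1.
Proof.
rewrite /ising_pr /ising_pmf (eq_bigl xpredT) => [|x]; last by rewrite finset.in_setT.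
under eq_bigr => x _ do rewrite -addrA expRD.
rewrite -big_distrl /= -opprD expRN expRD.
set S := \sum_(_ | _) _.
have S0 : 0 < S.
  by rewrite /S (bigD1 [ffun=> true]) //= ltr_pwDl ?expR_gt0 // sumr_ge0 // => *;
    exact: expR_ge0.
have p2 : (0 : R) < 2 ^+ n by rewrite exprn_gt0.
rewrite lnK ?posrE ?mulr_gt0 ?invr_gt0 //.
rewrite mulr_natl -lnXn // lnK ?posrE //.
by rewrite mulrAC mulVf ?gt_eqF // mul1r divff // gt_eqF.
Qed.

(* K * F^(-1/2) in the extended reals, with value +oo when F = 0
   (powR has 0 `^ (-1/2) = 0, so this case has to be separated). *)
Definition rate (R : realType) (K F : R) : \bar R :=
  if F == 0 then +oo%E else (K * F `^ (- 2^-1))%:E.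

(* Main.v *)
Require Import Defs.
From HB Require Import structures.
From mathcomp Require Import all_boot all_order all_algebra.
From mathcomp Require Import all_classical all_reals all_analysis.
From mathcomp Require Import ring lra.
Import Order.TTheory GRing.Theory Num.Theory.
Import numFieldNormedType.Exports.

Set Implicit Arguments.
Unset Strict Implicit.
Unset Printing Implicit Defensive.

Local Open Scope ring_scope.

(** Along the line [beta *: J0] the Ising model is a one-parameter exponential
family, with sufficient statistic the energy [T x = x^T J0 x / 2] and cumulant
function [F beta = log_partition (beta *: J0)]; so [F^`() = E T] and
[F^`(2) = Var T].  The estimator is the maximum likelihood estimator on
[[-M, M]].

The log-likelihood is concave in the parameter, so if the estimator passes
[b = beta +- h] then [b] is at least as likely as [beta]
([log_likelihood_between]).  Comparing the two likelihoods through their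
geometric mean bounds the probability of this by [expR (- g)], where
[g = (F beta + F b) / 2 - F ((beta + b) / 2)] ([ising_pr_likelihood_le]).
Everything then rests on the convexity gap [g] being at least of order
[min (F beta) (F beta * h ^+ 2)]: for [h] equal to the claimed rate, either [g]
exceeds [ln (2 / delta)], or [F beta] is so small that the rate exceeds
[2 * M] and there is nothing to prove.

The gap is large because of the differential inequality [c * |F'| <= F''] on
[[-M, M]], with [c] depending on [M] only ([energy_mean_le_variance]).  Let
[m_i = \sum_j J0 i j * x_j], [v_i = x_i * m_i], and let [N] be the mean of
[\sum_i m_i ^+ 2].  On the one hand [|F'| <= O(1) * N]
([norm_sum_energy_le]).  On the other hand the pseudo-score
[psi = \sum_i v_i * expR (- t * v_i)] has mean [0], covariance at least a
multiple of [N] with [T] ([cov_psi_ge]), and second moment at most a multiple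
of [N] ([sum_psi_sqr_le]), so that [Var T] is at least a multiple of [N] by
Cauchy-Schwarz ([sum_energy_sqr_ge]).  All three estimates come from the
exchange of the configurations that differ by one spin ([stein_identity]).

That the differential inequality implies the lower bound on the gap is a
fact about convex functions ([midpoint_gap_ge]): either [F] is far above its
tangent at the midpoint, or that tangent is steep, in which case [F''] is at
least of order [F beta] from the midpoint up to the larger of [beta] and [b]
(for [beta >= 0]; the other case is symmetric). *)

(** * Second-order convexity estimates *)

Section Convexity.
Variable R : realType.

Lemma derive_within_continuous (f f1 : R -> R) (a b : R) :
  (forall z : R, is_derive z 1 f (f1 z)) -> {within `[a, b], continuous f}%classic.
Proof.
move=> df; apply: derivable_within_continuous => z _.
by case: (df z).
Qed.

Lemma derive_ge0_homo (f f1 : R -> R) (a b : R) :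
  (forall z : R, is_derive z 1 f (f1 z)) ->
  (forall z, a <= z -> z <= b -> 0 <= f1 z) ->
  forall x y, a <= x -> x <= y -> y <= b -> f x <= f y.
Proof.
move=> df f1_ge0 x y ax xy yb.
have [z zxy fE] := @MVT_segment _ f f1 x y xy (fun z _ => df z)
  (@derive_within_continuous f f1 x y df).
move: zxy; rewrite in_itv /= => /andP[xz zy].
rewrite -subr_ge0 fE mulr_ge0 ?subr_ge0 // f1_ge0 ?(le_trans ax) //.
exact: le_trans yb.
Qed.

Lemma tangent_le (f f1 f2 : R -> R) (a b : R) :
  (forall z : R, is_derive z 1 f (f1 z)) ->
  (forall z : R, is_derive z 1 f1 (f2 z)) ->
  (forall z, a <= z -> z <= b -> 0 <= f2 z) ->
  forall x y, a <= x -> x <= b -> a <= y -> y <= b ->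
  f x + f1 x * (y - x) <= f y.
Proof.
move=> df df1 f2_ge0 x y ax xb ay yb.
have f1_homo := @derive_ge0_homo f1 f2 a b df1 f2_ge0.
case: (lerP x y) => [xy|/ltW yx].
  have [z] := @MVT_segment _ f f1 x y xy (fun z _ => df z)
    (@derive_within_continuous f f1 x y df).
  rewrite in_itv /= => /andP[xz zy] fE.
  have : f1 x <= f1 z by apply: f1_homo => //; exact: le_trans yb.
  move=> /(fun h => ler_wpM2r (_ : 0 <= y - x) h); rewrite subr_ge0 => /(_ xy).
  by rewrite -fE => h; lra.
have [z] := @MVT_segment _ f f1 y x yx (fun z _ => df z)
  (@derive_within_continuous f f1 y x df).
rewrite in_itv /= => /andP[yz zx] fE.
have : f1 z <= f1 x by apply: f1_homo => //; exact: le_trans yz.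
move=> /(fun h => ler_wpM2r (_ : 0 <= x - y) h); rewrite subr_ge0 => /(_ yx).
by rewrite -fE => h; lra.
Qed.

(** Subtracting [mu / 2 * s ^+ 2] from [f] reduces this to [tangent_le]. *)
Lemma tangent_le_quadratic (f f1 f2 : R -> R) (mu x y : R) :
  (forall z : R, is_derive z 1 f (f1 z)) ->
  (forall z : R, is_derive z 1 f1 (f2 z)) ->
  x <= y ->
  (forall z, x <= z -> z <= y -> mu <= f2 z) ->
  f x + f1 x * (y - x) + mu / 2 * (y - x) ^+ 2 <= f y.
Proof.
move=> df df1 xy f2_ge.
pose g (s : R) := f s - mu / 2 * (s * s).
have dg (z : R) : is_derive z 1 g (f1 z - mu * z).
  have -> : g = f - (mu / 2) \*: ((id : R -> R) * id) by [].
  have dfz := df z.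
  by apply: is_derive_eq; rewrite /GRing.scale /=; field.
pose g1 (s : R) := f1 s - mu * s.
have dg1 (z : R) : is_derive z 1 g1 (f2 z - mu).
  have -> : g1 = f1 - mu \*: id by [].
  have dfz := df1 z.
  by apply: is_derive_eq; rewrite /GRing.scale /= mulr1.
have := @tangent_le g g1 _ x y dg dg1 _ x y (lexx _) xy xy (lexx _).
rewrite /g /g1 => h.
suff : f x - mu / 2 * (x * x) + (f1 x - mu * x) * (y - x) <=
    f y - mu / 2 * (y * y).
  by move=> h'; lra.
by apply: h => z xz zy; rewrite subr_ge0 f2_ge.
Qed.

(** Write [m] for the midpoint.  Since [f b] lies above the tangent at [m], twice
the gap is at least the height of [f] above this tangent at [beta], or,
exchanging [beta] and [b], at [b].  If [beta <= b], then [f1] is at least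
[f1 beta >= f beta / M] on [[m, b]], and so [f2] is bounded below there.  If
[b <= beta], then either the height is at least [f beta / 2], or the tangent
at [m] is still at least [f beta / 2] at [beta]; being nonpositive at [0],
it has slope at least [f beta / (2 * M)], which bounds [f2] below on
[[m, beta]]. *)
Lemma midpoint_gap_ge_of_ge0 (f f1 f2 : R -> R) (M c beta b : R) :
  (forall z : R, is_derive z 1 f (f1 z)) ->
  (forall z : R, is_derive z 1 f1 (f2 z)) ->
  0 < M -> 0 <= c -> f 0 = 0 -> f1 0 = 0 ->
  (forall z, - M <= z -> z <= M -> c * `|f1 z| <= f2 z) ->
  0 <= beta -> beta <= M -> - M <= b -> b <= M ->
  Num.min (f beta / 4) (c / (32 * M) * f beta * (beta - b) ^+ 2) <=
  (f beta + f b) / 2 - f ((beta + b) / 2).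
Proof.
move=> df df1 M0 c0 f00 f10 f2_ge beta0 betaM Mb bM.
have f2_ge0 z : - M <= z -> z <= M -> 0 <= f2 z.
  by move=> Mz zM; apply: le_trans (f2_ge z Mz zM); rewrite mulr_ge0.
have tg := @tangent_le f f1 f2 (- M) M df df1 f2_ge0.
have homo1 := @derive_ge0_homo f1 f2 (- M) M df1 f2_ge0.
have MN : - M <= 0 by lra.
have f1b_ge : f beta <= M * f1 beta.
  have h1 := tg beta 0 ltac:(lra) betaM MN ltac:(lra).
  have h2 : 0 <= f1 beta by rewrite -f10; apply: homo1 => //; lra.
  nra.
have fb_ge0 : 0 <= f beta.
  by have := tg 0 beta MN ltac:(lra) ltac:(lra) betaM; rewrite f00 f10; lra.
pose m := (beta + b) / 2.
have mE : m = (beta + b) / 2 by [].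
rewrite -mE ge_min.
have Mm : - M <= m by lra.
have Q z (mu : R) : mu <= f1 z -> - M <= z -> z <= M -> c * mu <= f2 z.
  move=> h Mz zM; apply: le_trans (f2_ge z Mz zM).
  by rewrite ler_wpM2l // (le_trans h) // ler_norm.
case: (lerP beta b) => [betab|/ltW bbeta].
  apply/orP; right.
  have t1 := tg m beta ltac:(lra) ltac:(lra) ltac:(lra) betaM.
  have := @tangent_le_quadratic f f1 f2 (c * (f beta / M)) m b df df1 ltac:(lra) _.
  have H z : m <= z -> z <= b -> c * (f beta / M) <= f2 z.
    move=> mz zb; apply: Q; [|lra|lra].
    apply: (@le_trans _ _ (f1 beta)).
      by rewrite ler_pdivrMr // (mulrC _ M).
    by apply: homo1; lra.
  move=> /(_ H) t2.
  have -> : c / (32 * M) * f beta * (beta - b) ^+ 2 =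
    c * (f beta / M) * (b - m) ^+ 2 / 8 by rewrite mE; field; lra.
  set u := c * (f beta / M) in t2 *.
  have u0 : 0 <= u * (b - m) ^+ 2.
    by rewrite mulr_ge0 ?sqr_ge0 // mulr_ge0 // divr_ge0 // ltW.
  (* beta and b are symmetric about m, so the slopes at m cancel *)
  have -> : f m = f m + f1 m * (beta - m) + f1 m * (b - m) by rewrite mE; field.
  nra.
have t1 := tg m b ltac:(lra) ltac:(lra) Mb bM.
have gE : f m + f1 m * (b - m) = f m - f1 m * (beta - m) by rewrite mE; field.
case: (lerP (f beta / 2) (f beta - f m - f1 m * (beta - m))) => [h|h].
  by apply/orP; left; lra.
apply/orP; right.
have t0 := tg m 0 ltac:(lra) ltac:(lra) MN ltac:(lra).
have f1m : f beta / 2 <= beta * f1 m by lra.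
have f1m' : f beta / 2 <= M * f1 m.
  case: (lerP 0 (f1 m)) => [p|p]; nra.
have := @tangent_le_quadratic f f1 f2 (c * (f beta / 2 / M)) m beta df df1 ltac:(lra) _.
have H z : m <= z -> z <= beta -> c * (f beta / 2 / M) <= f2 z.
  move=> mz zb; apply: Q; [|lra|lra].
  apply: (@le_trans _ _ (f1 m)).
    by rewrite ler_pdivrMr // (mulrC _ M).
  by apply: homo1 => //; exact: le_trans betaM.
move=> /(_ H) t2.
have -> : c / (32 * M) * f beta * (beta - b) ^+ 2 =
  c * (f beta / 2 / M) * (beta - m) ^+ 2 / 4 by rewrite mE; field; lra.
lra.
Qed.

(** The hypothesis on [f2] is invariant under [f |-> f \o -%R]. *)
Lemma midpoint_gap_ge (f f1 f2 : R -> R) (M c beta b : R) :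
  (forall z : R, is_derive z 1 f (f1 z)) ->
  (forall z : R, is_derive z 1 f1 (f2 z)) ->
  0 < M -> 0 <= c -> f 0 = 0 -> f1 0 = 0 ->
  (forall z, - M <= z -> z <= M -> c * `|f1 z| <= f2 z) ->
  - M <= beta -> beta <= M -> - M <= b -> b <= M ->
  Num.min (f beta / 4) (c / (32 * M) * f beta * (beta - b) ^+ 2) <=
  (f beta + f b) / 2 - f ((beta + b) / 2).
Proof.
move=> df df1 M0 c0 f00 f10 f2_ge Mbeta betaM Mb bM.
case: (lerP 0 beta) => [beta0|/ltW beta0].
  exact: (@midpoint_gap_ge_of_ge0 f f1 f2).
have dN (z : R) : is_derive z 1 (-%R : R -> R) (- 1) by exact: is_deriveNid.
pose g (s : R) := f (- s); pose g1 (s : R) := - f1 (- s).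
have dg (z : R) : is_derive z 1 g (g1 z).
  have -> : g = f \o -%R by [].
  have dfz := df (- z).
  by apply: is_derive_eq; rewrite mulrN1.
have dg1 (z : R) : is_derive z 1 g1 (f2 (- z)).
  have -> : g1 = - (f1 \o -%R) by [].
  have dfz := df1 (- z).
  by apply: is_derive_eq; rewrite mulrN1 opprK.
have := @midpoint_gap_ge_of_ge0 g g1 _ M c (- beta) (- b) dg dg1 M0 c0.
rewrite /g /g1 oppr0 f10 oppr0 !opprK -opprD mulNr opprK.
rewrite (_ : (- beta + b) ^+ 2 = (beta - b) ^+ 2); last by ring.
apply => //; try lra.
by move=> z ? ?; rewrite normrN; apply: f2_ge; lra.
Qed.

End Convexity.

(** * Spin flips *)

Section Flip.
Variables (R : realType) (n : nat).
Implicit Types (A : 'M[R]_n) (x : config n) (i j : 'I_n).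

Definition spin_at x i : R := spin R x i 0.

Definition local_field A x i : R := \sum_j A i j * spin_at x j.

Definition energy A x : R := quad A x / 2.

Definition flip i x : config n := [ffun j => (j == i) (+) x j].

Lemma flipK i : involutive (flip i).
Proof. by move=> x; apply/ffunP => j; rewrite !ffunE addbA addbb. Qed.

Lemma norm_spin_at x i : `|spin_at x i| = 1.
Proof. by rewrite /spin_at mxE; case: (x i); rewrite ?normrN normr1. Qed.

Lemma spin_at_flip i x j :
  spin_at (flip i x) j = spin_at x j - 2 * spin_at x j * (j == i)%:R.
Proof.
rewrite /spin_at !mxE ffunE; case: (j == i); case: (x j) => /=; lra.
Qed.

Lemma local_field_flip A i x j :
  local_field A (flip i x) j = local_field A x j - 2 * A j i * spin_at x i.
Proof.
rewrite /local_field; under eq_bigr do rewrite spin_at_flip mulrBr.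
rewrite sumrB; congr (_ - _).
rewrite (bigD1 i) //= eqxx big1 => [|k /negbTE->]; first by rewrite ?mulr1n; ring.
by rewrite !mulr0.
Qed.

Lemma energyE A x :
  energy A x = (\sum_i spin_at x i * local_field A x i) / 2.
Proof.
rewrite /energy /quad -mulmxA mxE; congr (_ / 2); apply: eq_bigr => i _.
rewrite mxE /spin_at; congr (_ * _).
by rewrite mxE.
Qed.

(** The energy is affine in each spin, since the diagonal of [A] vanishes. *)
Lemma energy_flip A i x : interaction_matrix A ->
  energy A (flip i x) = energy A x - 2 * (spin_at x i * local_field A x i).
Proof.
move=> [symA diagA]; rewrite !energyE.
have diag0 y : local_field A (flip i y) i = local_field A y i.
  by rewrite local_field_flip diagA mulr0 mul0r subr0.
have E : \sum_j spin_at (flip i x) j * local_field A (flip i x) j =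
  \sum_j spin_at x j * local_field A x j - 2 * (spin_at x i * local_field A x i)
  - 2 * spin_at x i * local_field A (flip i x) i.
  rewrite [local_field A (flip i x) i]/local_field mulr_sumr.
  under eq_bigr do rewrite local_field_flip mulrBr.
  rewrite sumrB; congr (_ - _).
    under eq_bigr do rewrite spin_at_flip mulrBl.
    rewrite sumrB; congr (_ - _).
    rewrite (bigD1 i) //= eqxx big1 => [|k /negbTE->]; first by rewrite ?mulr1n; ring.
    by rewrite mulr0 mul0r.
  apply: eq_bigr => j _; have -> : A i j = A j i by rewrite -[in LHS]symA mxE.
  by ring.
by rewrite E diag0; field.
Qed.

End Flip.

Section RowSum.
Variables (R : realType) (n : nat) (A : 'M[R]_n).
Hypotheses (imA : interaction_matrix A) (A_le1 : infnorm A <= 1).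

Lemma row_sum_le1 i : \sum_j `|A i j| <= 1.
Proof.
apply: le_trans A_le1; rewrite /infnorm.
exact: (@le_bigmax _ _ _ 0 (fun i => \sum_j `|A i j|)).
Qed.

Lemma col_sum_le1 j : \sum_i `|A i j| <= 1.
Proof.
apply: le_trans (row_sum_le1 j); rewrite le_eqVlt; apply/orP; left; apply/eqP.
by apply: eq_bigr => i _; case: imA => symA _; rewrite -[in LHS]symA mxE.
Qed.

Lemma local_field_le1 x i : `|local_field A x i| <= 1.
Proof.
apply: le_trans (ler_norm_sum _ _ _) _; apply: le_trans (row_sum_le1 i).
by apply: ler_sum => j _; rewrite normrM norm_spin_at mulr1.
Qed.

End RowSum.

(** * A lower bound for the variance of the energy *)

Section ExpLipschitz.
Variable R : realType.

Lemma expR_lipschitz (a b c : R) : a <= c -> b <= c ->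
  `|expR a - expR b| <= expR c * `|a - b|.
Proof.
wlog ba : a b / b <= a.
  by move=> H ac bc; case/orP: (le_total b a) => h; [|rewrite distrC (distrC a)];
    exact: H.
move=> ac _; rewrite !ger0_norm ?subr_ge0 ?ler_expR //.
have -> : expR b = expR a * expR (b - a) by rewrite -expRD addrC subrK.
have -> : expR a - expR a * expR (b - a) = expR a * (1 - expR (b - a)) by ring.
apply: (@le_trans _ _ (expR a * (a - b))).
  by rewrite ler_wpM2l ?expR_ge0 //; have := expR_ge1Dx (b - a); lra.
by rewrite ler_wpM2r ?subr_ge0 // ler_expR.
Qed.

(** The difference is of second order: the map [v |-> v * expR (- (t * v)) - v] has
derivative [0] at [0].  This is what makes the second moment of the pseudo-score
quadratic in the local fields, and not merely linear. *)
Lemma tilted_diff (M t v v' : R) : `|t| <= M -> `|v| <= 1 -> `|v'| <= 1 ->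
  `|v * expR (- (t * v)) - v' * expR (- (t * v')) - (v - v')| <=
  M * expR M * (`|v - v'| * (`|v| + `|v'|)).
Proof.
move=> tM v1 v'1.
have M0 : 0 <= M by exact: le_trans tM.
have ntv u : `|u| <= 1 -> - (t * u) <= M.
  move=> u1; apply: le_trans (ler_norm _) _; rewrite normrN normrM.
  by rewrite -[M]mulr1 ler_pM.
have -> : v * expR (- (t * v)) - v' * expR (- (t * v')) - (v - v') =
  (v - v') * (expR (- (t * v)) - expR 0) +
  v' * (expR (- (t * v)) - expR (- (t * v'))) by rewrite expR0; ring.
have h1 := @expR_lipschitz _ _ M (ntv _ v1) M0.
have h2 := @expR_lipschitz _ _ M (ntv _ v1) (ntv _ v'1).
apply: le_trans (ler_normD _ _) _; rewrite !normrM mulrDr mulrDr.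
have Mt : expR M * `|t| <= M * expR M by rewrite mulrC ler_wpM2r ?expR_ge0.
apply: lerD.
  rewrite mulrCA ler_wpM2l //; apply: le_trans h1 _.
  by rewrite subr0 normrN normrM mulrA ler_wpM2r.
rewrite mulrA [leRHS]mulrC ler_wpM2l //; apply: le_trans h2 _.
rewrite -opprD normrN -mulrBr normrM mulrA ler_wpM2r //.
Qed.

End ExpLipschitz.

Section Variance.
Variables (R : realType) (n : nat) (A : 'M[R]_n) (M t : R).
Hypotheses (imA : interaction_matrix A) (A_le1 : infnorm A <= 1).
Hypothesis (tM : `|t| <= M).
Implicit Types (x : config n) (i j : 'I_n).

Let T := energy A.
Let m := local_field A.
Let v x i := spin_at R x i * m x i.
Let W x := expR (t * T x).
(* w i is W with the interaction of spin i removed, hence invariant under its flip *)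
Let w i x := expR (t * (T x - v x i)).

(** Like every sum over configurations in this section, this is an expectation
under the model with parameter [t], not yet divided by the partition function. *)
Definition field_energy : R :=
  \sum_x expR (t * energy A x) * \sum_i local_field A x i ^+ 2.

(* Since w i x = W x * expR (- (t * v x i)), every term of psi is centred given
   the other spins. *)
Let psi x := \sum_i v x i * expR (- (t * v x i)).

Let M_ge0 : 0 <= M. Proof. exact: le_trans tM. Qed.

Let T_flip i x : T (flip i x) = T x - 2 * v x i.
Proof. exact: energy_flip. Qed.

Let m_flip_diag i x : m (flip i x) i = m x i.
Proof. by rewrite /m local_field_flip imA.2 mulr0 mul0r subr0. Qed.

Let v_flip_diag i x : v (flip i x) i = - v x i.
Proof. by rewrite /v m_flip_diag spin_at_flip eqxx mulr1; ring. Qed.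

Let norm_v x i : `|v x i| = `|m x i|.
Proof. by rewrite /v normrM norm_spin_at mul1r. Qed.

Let sqr_v x i : v x i ^+ 2 = m x i ^+ 2.
Proof.
by rewrite -(real_normK (num_real (v x i))) norm_v real_normK // num_real.
Qed.

Let v_le1 x i : `|v x i| <= 1.
Proof. by rewrite norm_v local_field_le1. Qed.

Let tv_le x i : `|t * v x i| <= M.
Proof. by rewrite normrM -[M]mulr1 ler_pM. Qed.

Let wE i x : w i x = W x * expR (- (t * v x i)).
Proof. by rewrite /w /W -expRD mulrBr. Qed.

Let w_ge0 i x : 0 <= w i x. Proof. exact: expR_ge0. Qed.

Let w_flip i x : w i (flip i x) = w i x.
Proof. by rewrite /w T_flip v_flip_diag; congr (expR (t * _)); ring. Qed.

Let w_le i x : w i x <= expR M * W x.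
Proof.
rewrite wE mulrC ler_wpM2r ?expR_ge0 // ler_expR.
by apply: le_trans (ler_norm _) _; rewrite normrN.
Qed.

Let w_ge i x : expR (- M) * W x <= w i x.
Proof.
rewrite wE mulrC ler_wpM2l ?expR_ge0 // ler_expR lerN2.
exact: le_trans (ler_norm _) _.
Qed.

Lemma sum_flip i (h : config n -> R) :
  \sum_x w i x * h (flip i x) = \sum_x w i x * h x.
Proof.
rewrite [RHS](reindex_inj (inv_inj (flipK i))) /=.
by apply: eq_bigr => x _; rewrite w_flip.
Qed.

(** Flipping spin [i] preserves [w i] and changes the sign of [v _ i]. *)
Lemma stein_identity i (h : config n -> R) :
  \sum_x w i x * v x i * h x =
  (\sum_x w i x * (v x i * (h x - h (flip i x)))) / 2.
Proof.
have := sum_flip i (fun x => v x i * h x).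
under eq_bigr do rewrite v_flip_diag.
move=> E; under [in RHS]eq_bigr do rewrite mulrBr mulrBr.
rewrite sumrB.
have -> : \sum_x w i x * (v x i * h (flip i x)) = - \sum_x w i x * (v x i * h x).
  by rewrite -E -sumrN; apply: eq_bigr => x _; ring.
under eq_bigr do rewrite -mulrA.
by field.
Qed.

(** The energy is half the sum of the [v _ i], each of which has zero sum against
[w i]; and [w i] differs from [W] by a factor [1 + O(t * v _ i)]. *)
Lemma norm_sum_energy_le :
  `|\sum_x W x * T x| <= `|t| / 2 * expR M * field_energy.
Proof.
have vi i : `|\sum_x W x * v x i| <=
    `|t| * expR M * \sum_x W x * m x i ^+ 2.
  have := stein_identity i (fun _ => 1).
  rewrite [in RHS]big1 => [|x _]; last by rewrite subrr !mulr0.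
  under eq_bigr do rewrite mulr1.
  rewrite mul0r => E0.
  have -> : \sum_x W x * v x i = \sum_x W x * v x i - \sum_x w i x * v x i.
    by rewrite E0 subr0.
  rewrite -sumrB mulr_sumr.
  apply: le_trans (ler_norm_sum _ _ _) _; apply: ler_sum => x _.
  rewrite wE.
  have -> : W x * v x i - W x * expR (- (t * v x i)) * v x i =
    W x * (v x i * (expR 0 - expR (- (t * v x i)))) by rewrite expR0; ring.
  rewrite (normrM (W x)) (normrM (v x i)) (ger0_norm (expR_ge0 _)) [leRHS]mulrCA.
  rewrite ler_wpM2l ?expR_ge0 //.
  apply: (@le_trans _ _ (`|v x i| * (expR M * `|t * v x i|))).
    rewrite ler_wpM2l //.
    have -> : `|t * v x i| = `|0 - - (t * v x i)| by rewrite sub0r opprK.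
    apply: expR_lipschitz => //.
    by apply: le_trans (ler_norm _) _; rewrite normrN.
  rewrite (normrM t) -(sqr_v x i) -(real_normK (num_real (v x i))).
  rewrite le_eqVlt; apply/orP; left.
  by apply/eqP; ring.
have -> : \sum_x W x * T x = (\sum_i \sum_x W x * v x i) / 2.
  rewrite exchange_big /= mulr_suml; apply: eq_bigr => x _.
  by rewrite -mulr_sumr /T energyE mulrA.
rewrite normrM (ger0_norm (_ : 0 <= 2^-1)) ?invr_ge0 //.
have -> : `|t| / 2 * expR M * field_energy =
  (\sum_i `|t| * expR M * \sum_x W x * m x i ^+ 2) / 2.
  rewrite -mulr_sumr exchange_big /=.
  rewrite /field_energy; under [in RHS]eq_bigr do rewrite -mulr_sumr.
  by rewrite /W /T /m; ring.
rewrite ler_wpM2r ?invr_ge0 //.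
by apply: le_trans (ler_norm_sum _ _ _) _; apply: ler_sum.
Qed.

(** Each term of the pseudo-score turns the weight [W] into a weight [w i]. *)
Lemma sum_psiE (h : config n -> R) :
  \sum_x W x * (psi x * h x) = \sum_i \sum_x w i x * v x i * h x.
Proof.
rewrite exchange_big /=; apply: eq_bigr => x _.
rewrite /psi mulr_suml mulr_sumr; apply: eq_bigr => i _.
by rewrite wE; ring.
Qed.

Lemma sum_psi : \sum_x W x * psi x = 0.
Proof.
under eq_bigr do rewrite -[psi _]mulr1.
rewrite (sum_psiE (fun=> 1)) big1 // => i _.
rewrite (stein_identity i (fun=> 1)) big1 ?mul0r // => x _.
by rewrite subrr !mulr0.
Qed.

(** By [stein_identity], since flipping spin [i] changes the energy by [2 * v _ i]. *)
Lemma cov_psi_ge :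
  expR (- M) * field_energy <= \sum_x W x * (psi x * T x).
Proof.
rewrite sum_psiE /field_energy.
under [leRHS]eq_bigr do rewrite stein_identity.
rewrite -mulr_suml exchange_big /= mulr_suml mulr_sumr.
apply: ler_sum => x _; rewrite mulrA mulr_sumr mulr_suml.
apply: ler_sum => i _; rewrite T_flip -[local_field A x i ^+ 2]sqr_v.
have -> : w i x * (v x i * (T x - (T x - 2 * v x i))) / 2 = w i x * v x i ^+ 2.
  by field.
by rewrite ler_wpM2r ?sqr_ge0 ?w_ge.
Qed.

Let K1 := M * expR M.
Let K1_ge0 : 0 <= K1. Proof. by rewrite mulr_ge0 ?expR_ge0. Qed.

(** The first-order terms add up to [2 * (T x - T (flip i x)) = 4 * v x i], which is
much smaller than the sum of their absolute values; [tilted_diff] controls the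
rest. *)
Lemma psi_flip_le i x :
  `|psi x - psi (flip i x)| <= 4 * `|m x i| + 4 * K1 * m x i ^+ 2 +
  2 * K1 * \sum_j `|A j i| * (`|m x j| + `|m (flip i x) j|).
Proof.
have dv j : `|v x j - v (flip i x) j| * (`|v x j| + `|v (flip i x) j|) <=
    4 * m x i ^+ 2 * (j == i)%:R +
    2 * (`|A j i| * (`|m x j| + `|m (flip i x) j|)).
  rewrite (norm_v x j) (norm_v (flip i x) j); have [->|ji] := eqVneq j i.
    rewrite v_flip_diag m_flip_diag imA.2 normr0 mul0r mulr0 addr0 mulr1.
    have -> : v x i - - v x i = 2 * v x i by ring.
    rewrite (normrM 2) norm_v (ger0_norm (_ : 0 <= 2)) //.
    rewrite -(real_normK (num_real (m x i))).
    by rewrite le_eqVlt; apply/orP; left; apply/eqP; ring.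
  have -> : v x j - v (flip i x) j = 2 * (spin_at R x j * spin_at R x i * A j i).
    have -> : v (flip i x) j =
        spin_at R x j * (m x j - 2 * A j i * spin_at R x i).
      by rewrite /v /m local_field_flip spin_at_flip (negbTE ji) mulr0 subr0.
    by rewrite /v; ring.
  rewrite !normrM !norm_spin_at (ger0_norm (_ : 0 <= 2)) // !mul1r mulr0 add0r.
  by rewrite mulrA.
have -> : psi x - psi (flip i x) = 4 * v x i +
  \sum_j (v x j * expR (- (t * v x j)) -
          v (flip i x) j * expR (- (t * v (flip i x) j)) -
          (v x j - v (flip i x) j)).
  rewrite !sumrB -/(psi x) -/(psi (flip i x)).
  have h y : \sum_j v y j = 2 * T y by rewrite /T energyE; field.
  by rewrite !h T_flip; ring.
apply: le_trans (ler_normD _ _) _; rewrite -addrA; apply: lerD.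
  by rewrite normrM norm_v ger0_norm.
apply: le_trans (ler_norm_sum _ _ _) _.
apply: (@le_trans _ _ (\sum_j K1 * (4 * m x i ^+ 2 * (j == i)%:R +
    2 * (`|A j i| * (`|m x j| + `|m (flip i x) j|))))).
  apply: ler_sum => j _; apply: le_trans (tilted_diff tM _ _) _ => //.
  by rewrite ler_wpM2l.
rewrite -mulr_sumr big_split /= -!mulr_sumr (bigD1 i) //= eqxx big1 ?mulr1n.
  by rewrite le_eqVlt; apply/orP; left; apply/eqP; ring.
by move=> j /negbTE->.
Qed.

(** By [stein_identity] and [psi_flip_le]; the terms that involve the local fields
at [flip i x] are brought back to [x] by [sum_flip]. *)
Lemma sum_psi_sqr_le :
  \sum_x W x * psi x ^+ 2 <= expR M * (2 + 4 * K1) * field_energy.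
Proof.
have E i : (\sum_x w i x * (v x i * (psi x - psi (flip i x)))) / 2 <=
    (2 + 3 * K1) * (\sum_x w i x * m x i ^+ 2) +
    K1 * \sum_j `|A j i| * \sum_x w i x * m x j ^+ 2.
  have -> : \sum_j `|A j i| * \sum_x w i x * m x j ^+ 2 =
    \sum_x w i x * \sum_j `|A j i| * ((m x j ^+ 2 + m (flip i x) j ^+ 2) / 2).
    under [in RHS]eq_bigr do rewrite mulr_sumr.
    rewrite [in RHS]exchange_big /=; apply: eq_bigr => j _.
    (* half of the mass moves to the flipped configuration, as in psi_flip_le *)
    have h := sum_flip i (fun x => m x j ^+ 2).
    transitivity (`|A j i| * ((\sum_x w i x * m x j ^+ 2 +
        \sum_x w i x * m (flip i x) j ^+ 2) / 2)); first by rewrite h; field.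
    rewrite -big_split mulr_suml mulr_sumr; apply: eq_bigr => x _.
    by rewrite /=; field.
  rewrite mulr_suml !mulr_sumr -big_split; apply: ler_sum => x _ /=.
  set S := \sum_j _.
  have -> : (2 + 3 * K1) * (w i x * m x i ^+ 2) + K1 * (w i x * S) =
    w i x * ((2 + 3 * K1) * m x i ^+ 2 + K1 * S) by ring.
  rewrite -mulrA ler_wpM2l //.
  have H : \sum_j `|A j i| * (`|m x j| + `|m (flip i x) j|) * `|m x i| <=
      m x i ^+ 2 + S.
    apply: (@le_trans _ _ (\sum_j (`|A j i| * m x i ^+ 2 +
        `|A j i| * ((m x j ^+ 2 + m (flip i x) j ^+ 2) / 2)))).
      apply: ler_sum => j _; rewrite -mulrA -mulrDr ler_wpM2l //.
      rewrite -(real_normK (num_real (m x i))) -(real_normK (num_real (m x j))).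
      rewrite -(real_normK (num_real (m (flip i x) j))).
      have := sqr_ge0 (`|m x i| - `|m x j|).
      have := sqr_ge0 (`|m x i| - `|m (flip i x) j|).
      nra.
    rewrite big_split /= lerD2r -mulr_suml -[leRHS]mul1r.
    by rewrite ler_wpM2r ?sqr_ge0 // col_sum_le1.
  rewrite -mulr_suml in H.
  apply: (@le_trans _ _ (`|m x i| * `|psi x - psi (flip i x)| / 2)).
    by rewrite ler_wpM2r // -(norm_v x i) -normrM ler_norm.
  have := psi_flip_le i x.
  move: H; set B := \sum_j _ => H P.
  have {}P := ler_wpM2l (normr_ge0 (m x i)) P.
  have KH := ler_wpM2l K1_ge0 H.
  have m1 := local_field_le1 A_le1 x i; rewrite -/(m x i) in m1.
  have msq : m x i ^+ 2 = `|m x i| * `|m x i|.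
    by rewrite -expr2 real_normK // num_real.
  have m3 : K1 * (`|m x i| * m x i ^+ 2) <= K1 * m x i ^+ 2.
    by rewrite ler_wpM2l // -[leRHS]mul1r ler_wpM2r ?sqr_ge0.
  rewrite mulrDr mulrDr in P.
  nra.
under eq_bigr do rewrite expr2.
rewrite sum_psiE.
apply: (@le_trans _ _ (\sum_i expR M * ((2 + 3 * K1) * (\sum_x W x * m x i ^+ 2) +
    K1 * \sum_j `|A j i| * \sum_x W x * m x j ^+ 2))).
  apply: ler_sum => i _; rewrite stein_identity; apply: le_trans (E i) _.
  have H j : \sum_x w i x * m x j ^+ 2 <= expR M * \sum_x W x * m x j ^+ 2.
    rewrite mulr_sumr; apply: ler_sum => x _.
    by rewrite mulrA ler_wpM2r ?sqr_ge0.
  rewrite mulrDr; apply: lerD.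
    by rewrite [leRHS]mulrCA ler_wpM2l // addr_ge0 // mulr_ge0.
  rewrite [leRHS]mulrCA ler_wpM2l // mulr_sumr; apply: ler_sum => j _.
  by rewrite [leRHS]mulrCA ler_wpM2l.
rewrite -mulr_sumr -mulrA ler_wpM2l ?expR_ge0 // big_split /= -!mulr_sumr.
have NE : \sum_i \sum_x W x * m x i ^+ 2 = field_energy.
  rewrite exchange_big /=; apply: eq_bigr => x _; by rewrite mulr_sumr.
have : \sum_i \sum_j `|A j i| * \sum_x W x * m x j ^+ 2 <= field_energy.
  rewrite -NE exchange_big /=; apply: ler_sum => j _.
  rewrite -mulr_suml -[leRHS]mul1r ler_wpM2r ?row_sum_le1 //.
  by apply: sumr_ge0 => x _; rewrite mulr_ge0 ?expR_ge0 ?sqr_ge0.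
rewrite NE => h; have := ler_wpM2l K1_ge0 h; lra.
Qed.

(** Cauchy-Schwarz in the form of the nonnegativity of the second moment of
[T - mu - l * psi], which needs no case distinction when [field_energy] is [0]. *)
Lemma sum_energy_sqr_ge (mu : R) :
  expR (- M) ^+ 2 / (expR M * (2 + 4 * (M * expR M))) * field_energy <=
  \sum_x expR (t * energy A x) * (energy A x - mu) ^+ 2.
Proof.
set K := expR M * _; rewrite -/T.
have K0 : 0 < K.
  by rewrite mulr_gt0 ?expR_gt0 // ltr_wpDr // mulr_ge0.
(* the multiplier that optimises the bounds cov_psi_ge and sum_psi_sqr_le *)
pose l := expR (- M) / K.
have : 0 <= \sum_x W x * (T x - mu - l * psi x) ^+ 2.
  by apply: sumr_ge0 => x _; rewrite mulr_ge0 ?expR_ge0 ?sqr_ge0.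
have -> : \sum_x W x * (T x - mu - l * psi x) ^+ 2 =
  \sum_x W x * (T x - mu) ^+ 2 - 2 * l * (\sum_x W x * (psi x * T x)) +
  2 * l * mu * (\sum_x W x * psi x) + l ^+ 2 * \sum_x W x * psi x ^+ 2.
  rewrite !mulr_sumr -sumrB -!big_split /=; apply: eq_bigr => x _; ring.
rewrite sum_psi mulr0 addr0 -/(W _).
have l0 : 0 <= l by rewrite divr_ge0 ?expR_ge0 // ltW.
have h1 := ler_wpM2l l0 cov_psi_ge.
have h2 := ler_wpM2l (sqr_ge0 l) sum_psi_sqr_le.
rewrite -/K in h2.
have -> : expR (- M) ^+ 2 / K * field_energy = l * (expR (- M) * field_energy).
  by rewrite /l; field; lra.
have e2 : l ^+ 2 * (K * field_energy) = l * (expR (- M) * field_energy).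
  by rewrite /l; field; lra.
rewrite e2 in h2.
move=> h0; rewrite /W in h0 h1 h2 *; lra.
Qed.

End Variance.

(** * Derivatives of the log-partition function *)

Section LogPartition.
Variables (R : realType) (n : nat) (A : 'M[R]_n).
Implicit Types (x : config n) (t : R).

Lemma quadZ t x : quad (t *: A) x / 2 = t * energy A x.
Proof. by rewrite /quad -scalemxAr -scalemxAl mxE mulrA. Qed.

Definition energy_moment (k : nat) t : R :=
  \sum_x energy A x ^+ k * expR (t * energy A x).

Lemma energy_moment0_gt0 t : 0 < energy_moment 0 t.
Proof.
rewrite /energy_moment (bigD1 [ffun=> true]) //= ltr_pwDl ?mul1r ?expR_gt0 //.
by apply: sumr_ge0 => x _; rewrite mul1r expR_ge0.
Qed.

Lemma log_partitionE t :
  log_partition (t *: A) = ln (2 ^- n * energy_moment 0 t).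
Proof.
rewrite /log_partition /energy_moment; congr (ln (_ * _)).
by apply: eq_bigr => x _; rewrite quadZ expr0 mul1r.
Qed.

Lemma is_derive_energy_moment k (t : R) :
  is_derive t 1 (energy_moment k) (energy_moment k.+1 t).
Proof.
pose h x (t : R) := energy A x ^+ k * expR (t * energy A x).
pose dh x := energy A x ^+ k.+1 * expR (t * energy A x).
have dhx x : is_derive t 1 (h x) (dh x).
  have -> : h x = (energy A x ^+ k) \*: (expR \o (energy A x \*: (id : R -> R))).
    by apply/funext => s; rewrite /h /= /GRing.scale /= (mulrC s).
  apply: is_derive_eq; rewrite /dh /GRing.scale /= mulr1 exprSr (mulrC t).
  by ring.
have -> : energy_moment k = \sum_x h x by apply/funext => s; rewrite fct_sumE.
rewrite /energy_moment -/(dh _).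
by elim/big_ind2 : _ => // [|*]; [exact: is_derive_cst|exact: is_deriveD].
Qed.

Definition energy_mean t : R := energy_moment 1 t / energy_moment 0 t.

Definition energy_variance t : R :=
  energy_moment 2 t / energy_moment 0 t - energy_mean t ^+ 2.

Lemma is_derive_log_partition (t : R) :
  is_derive t 1 (fun s => log_partition (s *: A)) (energy_mean t).
Proof.
have -> : (fun s => log_partition (s *: A)) =
    @ln R \o ((2 ^- n : R) \*: energy_moment 0).
  by apply/funext => s; rewrite log_partitionE.
have Z0 := energy_moment0_gt0 t.
have p2 : 0 < (2 ^- n : R) by rewrite invr_gt0 exprn_gt0.
have dln := @is_derive1_ln R (2 ^- n * energy_moment 0 t) (mulr_gt0 p2 Z0).
have dZ := is_derive_energy_moment 0 t.
apply: is_derive_eq; rewrite /GRing.scale /= /energy_mean.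
by rewrite invfM mulrACA mulVf ?gt_eqF // mul1r mulrC.
Qed.

Lemma is_derive_energy_mean (t : R) :
  is_derive t 1 energy_mean (energy_variance t).
Proof.
have -> : energy_mean = energy_moment 1 * (fun s => (energy_moment 0 s)^-1).
  by [].
have Z0 := energy_moment0_gt0 t.
have dZ1 := is_derive_energy_moment 1 t.
have dZ := is_deriveV (lt0r_neq0 Z0) (is_derive_energy_moment 0 t).
apply: is_derive_eq; rewrite /GRing.scale /= /energy_variance /energy_mean.
by field; rewrite gt_eqF.
Qed.

Lemma energy_varianceE t : energy_variance t =
  (\sum_x expR (t * energy A x) * (energy A x - energy_mean t) ^+ 2) /
  energy_moment 0 t.
Proof.
set mu := energy_mean t.
have Z0 := energy_moment0_gt0 t.
have -> : \sum_x expR (t * energy A x) * (energy A x - mu) ^+ 2 =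
  energy_moment 2 t - 2 * mu * energy_moment 1 t + mu ^+ 2 * energy_moment 0 t.
  rewrite /energy_moment !mulr_sumr -sumrB -big_split /=.
  by apply: eq_bigr => x _; ring.
have -> : energy_moment 1 t = mu * energy_moment 0 t.
  by rewrite /mu /energy_mean divfK // gt_eqF.
by rewrite /energy_variance -/mu; field; rewrite gt_eqF.
Qed.

Lemma energy_variance_ge0 t : 0 <= energy_variance t.
Proof.
rewrite energy_varianceE divr_ge0 // ?(ltW (energy_moment0_gt0 t)) //.
by apply: sumr_ge0 => x _; rewrite mulr_ge0 ?expR_ge0 ?sqr_ge0.
Qed.

Lemma log_partition0 : log_partition (0 *: A) = 0.
Proof.
rewrite log_partitionE /energy_moment.
under eq_bigr do rewrite expr0 mul0r expR0 mulr1.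
rewrite sumr_const card_ffun card_bool card_ord natrX mulVf ?ln1 //.
Qed.

End LogPartition.

(** The ratio of the constants of [sum_energy_sqr_ge] and [norm_sum_energy_le],
the latter with [`|t|] replaced by [M]. *)
Definition curvature_cst (R : realType) (M : R) : R :=
  2 * (expR (- M) ^+ 2 / (expR M * (2 + 4 * (M * expR M)))) / (M * expR M).

Lemma curvature_cst_gt0 (R : realType) (M : R) :
  0 < M -> 0 < curvature_cst M.
Proof.
move=> M0; have e0 := expR_gt0 M; have Me := mulr_gt0 M0 e0.
rewrite divr_gt0 // mulr_gt0 // divr_gt0 ?exprn_gt0 ?expR_gt0 //.
by rewrite mulr_gt0 //; lra.
Qed.

Section Curvature.
Variables (R : realType) (n : nat) (A : 'M[R]_n).
Hypotheses (imA : interaction_matrix A) (A_le1 : infnorm A <= 1).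

Lemma energy_momentE1 t :
  energy_moment A 1 t = \sum_x expR (t * energy A x) * energy A x.
Proof. by apply: eq_bigr => x _; rewrite expr1 mulrC. Qed.

Lemma energy_mean0 : energy_mean A 0 = 0.
Proof.
rewrite /energy_mean energy_momentE1.
have := @norm_sum_energy_le R n A 0 0 imA A_le1.
rewrite normr0 lexx => /(_ isT); rewrite mul0r mul0r mul0r normr_le0 => /eqP->.
by rewrite mul0r.
Qed.

Lemma energy_mean_le_variance (M t : R) : 0 < M -> - M <= t -> t <= M ->
  curvature_cst M * `|energy_mean A t| <= energy_variance A t.
Proof.
move=> M0 Mt tM; have tM' : `|t| <= M by rewrite ler_norml Mt tM.
have Z0 := energy_moment0_gt0 A t.
rewrite energy_varianceE /energy_mean normrM normfV (gtr0_norm Z0) mulrA.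
rewrite ler_pM2r ?invr_gt0 // energy_momentE1.
apply: le_trans (sum_energy_sqr_ge imA A_le1 tM' _).
have N0 : 0 <= field_energy A t.
  apply: sumr_ge0 => x _; rewrite mulr_ge0 ?expR_ge0 ?sumr_ge0 // => i _.
  exact: sqr_ge0.
have e0 := expR_gt0 M.
apply: (@le_trans _ _ (curvature_cst M * (M / 2 * expR M * field_energy A t))).
  rewrite (ler_wpM2l (ltW (curvature_cst_gt0 M0))) //.
  apply: le_trans (norm_sum_energy_le imA A_le1 tM') _.
  by rewrite ler_wpM2r // (ler_wpM2r (ltW e0)) // ler_pM2r ?invr_gt0.
rewrite /curvature_cst le_eqVlt; apply/orP; left; apply/eqP.
have Me := mulr_gt0 M0 e0.
by field; rewrite ?gt_eqF //; lra.
Qed.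

End Curvature.

(** * Likelihood comparison and the maximum likelihood estimator *)

Section Likelihood.
Variables (R : realType) (n : nat) (A : 'M[R]_n).
Implicit Types (x : config n) (E : {set config n}).

Definition log_likelihood x (t : R) : R :=
  t * energy A x - log_partition (t *: A).

Lemma ising_pmfE t x :
  ising_pmf (t *: A) x = expR (log_likelihood x t - n%:R * ln 2).
Proof. by rewrite /ising_pmf quadZ. Qed.

Lemma ising_pmf_ge0 (J : 'M[R]_n) x : 0 <= ising_pmf J x.
Proof. exact: expR_ge0. Qed.

Lemma ising_prC (J : 'M[R]_n) E : ising_pr J E = 1 - ising_pr J (~: E).
Proof.
have := ising_pr_setT J; rewrite /ising_pr (bigID (mem E)) /= => <-.
rewrite [X in _ = X + _ - _](eq_bigl (mem E)); last by move=> x; rewrite !inE.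
rewrite [X in _ = _ + X - _](eq_bigl (mem (~: E))); last first.
  by move=> x; rewrite !inE.
by rewrite addrK.
Qed.

Lemma le_ising_pr (J : 'M[R]_n) (E E' : {set config n}) :
  E \subset E' -> ising_pr J E <= ising_pr J E'.
Proof.
move=> sub; rewrite /ising_pr [leRHS](bigID (mem E)) /=.
rewrite [X in _ <= X + _](eq_bigl (mem E)) => [|x].
  by rewrite lerDl sumr_ge0 // => x _; exact: ising_pmf_ge0.
by rewrite inE andbC; case: (boolP (x \in E)) => //= /(fintype.subsetP sub) ->.
Qed.

Lemma ising_pr_setU_le (J : 'M[R]_n) (E E' : {set config n}) :
  ising_pr J (E :|: E') <= ising_pr J E + ising_pr J E'.
Proof.
rewrite /ising_pr (bigID (mem E)) /=.
apply: lerD; rewrite le_eqVlt.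
  by apply/orP; left; apply/eqP/eq_bigl => x; rewrite !inE; case: (x \in E);
    rewrite ?andbF.
rewrite -le_eqVlt [leRHS](bigID (mem E)) /= ler_wpDl //.
  by apply: sumr_ge0 => x _; exact: ising_pmf_ge0.
rewrite le_eqVlt; apply/orP; left; apply/eqP/eq_bigl => x; rewrite !inE.
by case: (x \in E); rewrite ?andbF.
Qed.

(** Bounding the indicator of the event by the square root of the likelihood ratio
gives the Hellinger affinity of the two models; up to normalisation, the
geometric mean of their densities is the density at the midpoint. *)
Lemma ising_pr_likelihood_le (beta b : R) :
  ising_pr (beta *: A)
    [set x | log_likelihood x beta <= log_likelihood x b] <=
  expR (- ((log_partition (beta *: A) + log_partition (b *: A)) / 2 -
           log_partition (((beta + b) / 2) *: A))).
Proof.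
set g := (X in expR (- X)); set E := finset _.
have -> : expR (- g) =
    expR (- g) * ising_pr (((beta + b) / 2) *: A) [set: config n].
  by rewrite ising_pr_setT mulr1.
apply: (@le_trans _ _ (expR (- g) * ising_pr (((beta + b) / 2) *: A) E)).
  rewrite /ising_pr mulr_sumr; apply: ler_sum => x; rewrite inE => le_l.
  rewrite !ising_pmfE -expRD ler_expR; move: le_l; rewrite /g /log_likelihood.
  move: (log_partition (beta *: A)) (log_partition (b *: A))
    (log_partition (_ *: A)) (energy A x) (n%:R * ln 2) => F1 F2 F3 e k; lra.
by rewrite ler_wpM2l ?expR_ge0 // le_ising_pr // subsetT.
Qed.

Lemma log_likelihood_max (M : R) : 0 < M ->
  exists mle : config n -> R, forall x, `|mle x| <= M /\
    forall t, - M <= t -> t <= M -> log_likelihood x t <= log_likelihood x (mle x).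
Proof.
move=> M0; suff /choice[mle mleP] : forall x, exists b : R, `|b| <= M /\
    forall t, - M <= t -> t <= M -> log_likelihood x t <= log_likelihood x b.
  by exists mle.
move=> x.
have dl (t : R) : is_derive t 1 (log_likelihood x) (energy A x - energy_mean A t).
  have -> : log_likelihood x = (energy A x \*: (id : R -> R)) -
      (fun s => log_partition (s *: A)).
    by apply/funext => s; rewrite /log_likelihood /= mulrC.
  have dF := is_derive_log_partition A t.
  by apply: is_derive_eq; rewrite /GRing.scale /= mulr1.
have [b b_in b_max] := @EVT_max R (log_likelihood x) (- M) M ltac:(lra)
  (derive_within_continuous dl).
exists b; move: b_in; rewrite in_itv /= => /andP[Mb bM].
split; first by rewrite ler_norml Mb bM.
by move=> t Mt tM; apply: b_max; rewrite in_itv /= Mt tM.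
Qed.

(** The log-likelihood is concave: [T] is constant in [t] and [F] is convex. *)
Lemma log_likelihood_between (x : config n) (beta b c : R) :
  log_likelihood x beta <= log_likelihood x c ->
  (beta <= b) && (b <= c) || (c <= b) && (b <= beta) ->
  log_likelihood x beta <= log_likelihood x b.
Proof.
move=> le_l bw; rewrite leNgt; apply/negP => lt_l.
pose K := `|beta| + `|b| + `|c|.
have inK z : `|z| <= K -> - K <= z /\ z <= K by rewrite ler_norml => /andP[].
have [[b1 b2] [c1 c2] [d1 d2]] : [/\ - K <= b /\ b <= K, - K <= c /\ c <= K &
    - K <= beta /\ beta <= K].
  have := (normr_ge0 b, normr_ge0 c, normr_ge0 beta) => -[[p q] r].
  by split; apply: inK; rewrite /K; clear le_l lt_l bw; lra.
have tg := @tangent_le R (fun s => log_partition (s *: A)) (energy_mean A)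
  (energy_variance A) (- K) K
  (is_derive_log_partition A) (is_derive_energy_mean A)
  (fun z _ _ => energy_variance_ge0 A z).
have := tg b beta b1 b2 d1 d2; have := tg b c b1 b2 c1 c2.
move: lt_l le_l; rewrite /log_likelihood; clear tg b1 b2 c1 c2 d1 d2.
move: (log_partition (b *: A)) (log_partition (c *: A))
  (log_partition (beta *: A)) (energy_mean A b) (energy A x).
move=> Fb Fc Fbeta u T lt_l le_l t2 t1.
have p1 : 0 < (T - u) * (beta - b) by lra.
have p2 : 0 < (T - u) * (c - b) by lra.
case: (lerP (T - u) 0) => [Tu|/ltW Tu]; case/orP: bw => /andP[h1 h2].
- have : (T - u) * (c - b) <= 0 by rewrite mulr_le0_ge0 // subr_ge0.
  lra.
- have : (T - u) * (beta - b) <= 0 by rewrite mulr_le0_ge0 // subr_ge0.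
  lra.
- have : (T - u) * (beta - b) <= 0 by rewrite mulr_ge0_le0 // subr_le0.
  lra.
- have : (T - u) * (c - b) <= 0 by rewrite mulr_ge0_le0 // subr_le0.
  lra.
Qed.

End Likelihood.

Section Deviation.
Variables (R : realType) (n : nat) (A : 'M[R]_n) (M : R) (mle : config n -> R).
Hypotheses (imA : interaction_matrix A) (A_le1 : infnorm A <= 1) (M0 : 0 < M).
Hypothesis mle_le : forall x, `|mle x| <= M.
Hypothesis mle_max : forall x t, - M <= t -> t <= M ->
  log_likelihood A x t <= log_likelihood A x (mle x).

Lemma mle_deviation_at (beta b : R) : `|beta| <= M -> `|b| <= M ->
  ising_pr (beta *: A)
    [set x | (beta <= b) && (b <= mle x) || (mle x <= b) && (b <= beta)] <=
  expR (- Num.min (log_partition (beta *: A) / 4)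
    (curvature_cst M / (32 * M) * log_partition (beta *: A) * (beta - b) ^+ 2)).
Proof.
rewrite !ler_norml => /andP[Mbeta betaM] /andP[Mb bM].
apply: (@le_trans _ _ (ising_pr (beta *: A)
    [set x | log_likelihood A x beta <= log_likelihood A x b])).
  apply: le_ising_pr; apply/fintype.subsetP => x; rewrite !inE.
  exact: (log_likelihood_between (mle_max x Mbeta betaM)).
apply: le_trans (ising_pr_likelihood_le _ _ _) _.
rewrite ler_expR lerN2.
exact: (@midpoint_gap_ge R (fun s => log_partition (s *: A))
  (energy_mean A) (energy_variance A) M (curvature_cst M) beta b
  (is_derive_log_partition A) (is_derive_energy_mean A) M0
  (ltW (curvature_cst_gt0 M0)) (log_partition0 A) (energy_mean0 imA A_le1)
  (fun z => @energy_mean_le_variance R n A imA A_le1 M z M0)).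
Qed.

Lemma mle_deviation (beta h : R) : `|beta| <= M -> 0 <= h ->
  ising_pr (beta *: A) [set x | h < `|mle x - beta|] <=
  2 * expR (- Num.min (log_partition (beta *: A) / 4)
    (curvature_cst M / (32 * M) * log_partition (beta *: A) * h ^+ 2)).
Proof.
move=> betaM h0; set e := expR _.
(* The estimator stays in [-M, M], so it passes b only if b lies there too. *)
have side b : (beta - b) ^+ 2 = h ^+ 2 ->
  ising_pr (beta *: A) [set x | `|b| <= M &
    ((beta <= b) && (b <= mle x) || (mle x <= b) && (b <= beta))] <= e.
  move=> sqr_b; case: (boolP (`|b| <= M)) => bM /=.
    by rewrite /e -sqr_b; exact: mle_deviation_at.
  by rewrite /ising_pr big_pred0 ?expR_ge0 // => x; rewrite !inE.
rewrite mulr_natl mulr2n.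
apply: le_trans (lerD (side (beta + h) _) (side (beta - h) _)); [|ring|ring].
apply: le_trans (ising_pr_setU_le _ _ _).
apply: le_ising_pr; apply/fintype.subsetP => x; rewrite !inE.
have := mle_le x; move: betaM; rewrite !ler_norml lter_normr.
move=> /andP[? ?] /andP[? ?] /orP[] ?; apply/orP; [left|right].
  apply/andP; split; first by apply/andP; split; lra.
  by apply/orP; left; apply/andP; split; lra.
apply/andP; split; first by apply/andP; split; lra.
by apply/orP; right; apply/andP; split; lra.
Qed.

End Deviation.

(** * Choice of the constant *)

(** That is, [e < 3]: [expR (- 1) >= (1 - 1 / 6) ^+ 6 = 0.334...]. *)
Lemma ln_ln3_gt0 (R : realType) : 0 < ln (ln (3%:R : R)).
Proof.
apply: ln_gt0; rewrite -ltr_expR lnK ?posrE ?ltr0n //.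
have e6 : (5 / 6 : R) ^+ 6 <= expR (- 1).
  have -> : - 1 = 6%:R * (- 6^-1) :> R by field.
  rewrite expRM_natl lerXn2r ?nnegrE ?expR_ge0 //; try lra.
  by have := expR_ge1Dx (- 6^-1 : R); lra.
have e0 := expR_gt0 (1 : R).
have e1 := expRxMexpNx_1 (1 : R).
have : 3^-1 < expR (- 1 : R) by apply: lt_le_trans e6; lra.
move=> h; have : expR 1 * 3^-1 < expR 1 * expR (- 1 : R) by rewrite ltr_pM2l.
rewrite e1; lra.
Qed.

Theorem corollary10 (R : realType) :
  forall M : R, 0 < M ->
  exists C : R, 0 < C /\
  forall (n : nat), (3 <= n)%N ->
  forall delta : R, 0 < delta -> delta < 1 ->
  forall J0 : 'M[R]_n, interaction_matrix J0 -> infnorm J0 <= 1 ->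
  exists betahat : config n -> R,
  forall beta : R, `|beta| <= M ->
    1 - delta <=
    ising_pr (beta *: J0)
      [set x : config n |
        (`|betahat x - beta|%:E <=
         rate (C * (ln (ln n%:R) + ln (1 / delta)))
              (log_partition (beta *: J0)))%E].
Proof.
move=> M M0.
pose L0 : R := ln (ln 3%:R); have L00 : 0 < L0 := ln_ln3_gt0 R.
pose c := curvature_cst M / (32 * M).
have c0 : 0 < c by rewrite divr_gt0 ?curvature_cst_gt0 // mulr_gt0.
(* ln (2 / delta) <= C0 * (ln (ln n) + ln (1 / delta)): the term ln (ln n) >= L0
   pays for ln 2 *)
pose C0 := 1 + ln 2 / L0.
have ln2 : 0 <= ln 2 :> R by rewrite ln_ge0 // ler1n.
have C00 : 0 < C0 by rewrite ltr_pwDl // divr_ge0 // ltW.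
(* The second term serves when F is large, the third when F is small; the 1
   gives C <= C ^+ 2. *)
pose C := 1 + C0 / (c * L0) + 16 * M ^+ 2 * C0 / L0.
have q1 : 0 <= C0 / (c * L0) by rewrite ltW // divr_gt0 // mulr_gt0.
have q2 : 0 <= 16 * M ^+ 2 * C0 / L0.
  by rewrite ltW // divr_gt0 // mulr_gt0 // mulr_gt0 // exprn_gt0.
have C1 : 1 <= C by rewrite /C; lra.
have CC : C <= C ^+ 2 by rewrite expr2 ler_peMl //; lra.
exists C; split; first by lra.
move=> n n3 delta d0 d1 J0 imJ J_le1.
have [mle mleP] := log_likelihood_max J0 M0.
exists mle => beta betaM.
set L := ln (ln n%:R) + ln (1 / delta).
set F := log_partition (beta *: J0).
have [F0|Fn0] := eqVneq F 0.
  rewrite (_ : finset _ = [set: config n]); first by rewrite ising_pr_setT; lra.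
  by apply/setP => x; rewrite !inE /rate F0 eqxx leey.
have d_ln : 0 <= ln (1 / delta) by rewrite ln_ge0 // ler_pdivlMr // mul1r ltW.
have lnln_ge : L0 <= ln (ln n%:R).
  rewrite ler_ln ?posrE; first by rewrite ler_ln ?posrE ?ltr0n ?ler_nat //
    (leq_trans _ n3).
  - by rewrite ln_gt0 // ltr1n.
  - by rewrite ln_gt0 // ltr1n (leq_trans _ n3).
have L_ge : L0 <= L by rewrite /L; lra.
have F0 : 0 < F.
  rewrite lt_neqAle eq_sym Fn0 /=.
  have := @tangent_le R (fun s => log_partition (s *: J0)) (energy_mean J0)
    (energy_variance J0) (- M) M (is_derive_log_partition J0)
    (is_derive_energy_mean J0) (fun z _ _ => energy_variance_ge0 J0 z) 0 beta.
  rewrite log_partition0 energy_mean0 // mul0r addr0; apply; move: betaM;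
    rewrite ?ler_norml; lra.
pose Ld := ln (2 / delta).
have LdE : Ld = ln 2 + ln (1 / delta).
  by rewrite -lnM ?posrE ?divr_gt0 // mul1r.
have Ld_le : Ld <= C0 * L.
  have : ln 2 <= ln 2 / L0 * L.
    by rewrite -mulrA ler_peMr // mulrC ler_pdivlMr // mul1r.
  have : ln (1 / delta) <= L by rewrite /L; lra.
  by rewrite LdE /C0; lra.
pose p := F `^ (- 2^-1).
have p0 : 0 <= p by exact: powR_ge0.
have pp : F * p ^+ 2 = 1.
  rewrite /p powRN powR12_sqrt ?ltW // exprVn sqr_sqrtr ?ltW //.
  by rewrite mulfV.
pose h := C * L * p.
have L1 : 0 < L by exact: lt_le_trans L_ge.
have h0 : 0 <= h by rewrite !mulr_ge0 //; lra.
have goodE : [set x : config n | (`|mle x - beta|%:E <= rate (C * L) F)%E] =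
    ~: [set x | h < `|mle x - beta|].
  by apply/setP => x; rewrite !inE /rate (negbTE Fn0) lee_fin -leNgt.
have hF : F * h ^+ 2 = C ^+ 2 * L ^+ 2.
  by rewrite /h !exprMn mulrCA pp mulr1.
have CL a : 0 <= a -> a / L0 <= C -> a * L <= C ^+ 2 * L ^+ 2.
  move=> a0; rewrite ler_pdivrMr // => aC.
  rewrite (expr2 L) mulrA (ler_wpM2r (ltW L1)) //.
  apply: le_trans aC _; apply: ler_pM => //; lra.
rewrite goodE ising_prC finset.setCK lerD2l lerN2.
case: (lerP Ld (F / 4)) => [F_big|F_small].
  apply: le_trans (mle_deviation imJ J_le1 M0 (fun x => (mleP x).1)
    (fun x => (mleP x).2) betaM h0) _.
  have -> : delta = 2 * expR (- Ld).
    by rewrite expRN lnK ?posrE ?divr_gt0 // invf_div mulrC divfK.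
  rewrite ler_pM2l // ler_expR lerN2 le_min F_big /= -mulrA hF -/c.
  apply: le_trans Ld_le _.
  rewrite -ler_pdivrMl // mulrA (mulrC c^-1); apply: CL.
    by rewrite ltW // divr_gt0.
  by rewrite -mulrA -invfM /C; lra.
(* F < 4 * ln (2 / delta): the rate exceeds the diameter of [-M, M] *)
rewrite /ising_pr big_pred0 ?ltW // => x; rewrite !inE.
apply/negbTE; rewrite -leNgt.
apply: (@le_trans _ _ (2 * M)).
  by apply: le_trans (ler_normB _ _) _; have := (mleP x).1; lra.
have M2 : 0 <= 2 * M by lra.
rewrite -(ler_pXn2r (_ : (0 < 2)%N)) ?nnegrE //.
rewrite -(ler_pM2l F0) hF.
apply: (@le_trans _ _ (16 * M ^+ 2 * C0 * L)); last first.
  by apply: CL; [rewrite mulr_ge0 ?(ltW C00) // mulr_ge0 ?sqr_ge0|rewrite /C; lra].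
have -> : F * (2 * M) ^+ 2 = 16 * M ^+ 2 * (F / 4) by field.
rewrite -(mulrA _ C0) ler_wpM2l ?mulr_ge0 ?(ltW M0) //.
exact: le_trans (ltW F_small) Ld_le.
Qed.
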